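(* Let $n\ge 2$, let $\mathbf X=(X_1,\dots,X_n)$ be a random vector whose marginals are uniform on $[0,1]$, let $C$ be its $n$-copula, and let $\alpha\in\{-1,1\}^n$. Let $I=\{i:\alpha_i=-1\}$ and $J=\{1,\dots,n\}\setminus I=\{i:\alpha_i=1\}$. Then $$\rho_n^\alpha(C)=\frac{2^n(n+1)}{2^n-(n+1)}\sum_{S\subseteq J}(-1)^{|S|}\,\frac{2^{|I|+|S|}-(|I|+|S|+1)}{2^{|I|+|S|}(|I|+|S|+1)}\,\rho^-_{\mathbf X_{I\cup S}},$$ where the terms with $|I\cup S|\le 1$ are taken to be $0$ (their coefficient $2^m-(m+1)$ vanishes for $m\in\{0,1\}$).
   Context: For $\alpha\in\{-1,1\}^n$ and $\mathbf X$ with uniform $[0,1]$ marginals and copula $C$: $Q_\alpha(u)=\mathbb P\big[\bigcap_{i=1}^n\{\alpha_iX_i>\alpha_iu_i\}\big]-\prod_{i=1}^n\mathbb P[\alpha_iX_i>\alpha_iu_i]$ and $\rho_n^\alpha(C)=\frac{2^n(n+1)}{2^n-(n+1)}\int_{[0,1]^n}Q_\alpha(u)\,du$. For $K\subseteq\{1,\dots,n\}$ with $k=|K|\ge 2$, $\mathbf X_K=(X_i)_{i\in K}$, $C_K$ denotes its $k$-copula (the $K$-marginal of $C$, i.e. $C$ with the arguments outside $K$ set to $1$), and $\rho^-_{\mathbf X_K}=\frac{k+1}{2^k-(k+1)}\Big(2^k\int_{[0,1]^k}C_K(\mathbf u)\,d\mathbf u-1\Big)$ (equivalently $\rho_k^{(-1,\dots,-1)}(C_K)$).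 *)

(* Defs.v *)
From HB Require Import structures.
From mathcomp Require Import all_boot all_order all_algebra.
From mathcomp Require Import all_classical all_reals all_analysis.
Set Implicit Arguments. Unset Strict Implicit. Unset Printing Implicit Defensive.
Import Order.TTheory GRing.Theory Num.Theory.
Local Open Scope classical_set_scope.
Local Open Scope ring_scope.

Section Defs.
Variable R : realType.
Variable n : nat.

Definition setc (u : 'I_n -> R) (i : 'I_n) (t : R) : 'I_n -> R :=
  fun j => if j == i then t else u j.

Fixpoint iter_int (s : seq 'I_n) (f : ('I_n -> R) -> R) (u : 'I_n -> R) : R :=
  match s with
  | [::] => f u
  | i :: s' => Rintegral (@lebesgue_measure R) `[0%R, 1%R]
                 (fun t => iter_int s' f (setc u i t))
  end.

(* integral over [0,1]^K of f, f depending only on the coordinates in K *)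
Definition cube_int (K : {set 'I_n}) (f : ('I_n -> R) -> R) : R :=
  iter_int (enum K) f (fun _ => 0).

Variables (d : measure_display) (Omega : measurableType d)
  (P : probability Omega R) (X : 'I_n -> Omega -> R).

(* the n-copula of X (marginals uniform): C(u) = P[X_i <= u_i for all i] *)
Definition copula (u : 'I_n -> R) : R :=
  fine (P [set w | forall i, X i w <= u i]).

Definition copula_marg (K : {set 'I_n}) (u : 'I_n -> R) : R :=
  copula (fun i => if i \in K then u i else 1).

Definition rho_minus (K : {set 'I_n}) : R :=
  let k := #|K| in
  (k.+1)%:R / (2 ^+ k - (k.+1)%:R) * (2 ^+ k * cube_int K (copula_marg K) - 1).

Definition Q_alpha (alpha : 'I_n -> int) (u : 'I_n -> R) : R :=
  fine (P [set w | forall i, (alpha i)%:~R * X i w > (alpha i)%:~R * u i])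
  - \prod_(i < n) fine (P [set w | (alpha i)%:~R * X i w > (alpha i)%:~R * u i]).

Definition rho_alpha (alpha : 'I_n -> int) : R :=
  (2 ^+ n * (n.+1)%:R) / (2 ^+ n - (n.+1)%:R) * cube_int [set: 'I_n]%SET (Q_alpha alpha).

End Defs.

(* Main.v *)
(** Writing [P[X_i > u_i]] events as complements, inclusion-exclusion expands
    [Q_alpha u] into [sum_S (-1)^|S| (C_K(u) - prod_(i in K) F_i(u_i))] with
    [K = I :|: S]; the marginals being continuous, strict and large inequalities
    do not matter.  The [K]-term depends on the coordinates in [K] only, so its
    integral over the cube is [int C_K - 2^-|K|], which is the stated multiple
    of [rho_minus K]. *)
Require Import Defs.
From HB Require Import structures.
From mathcomp Require Import all_boot all_order all_algebra.
From mathcomp Require Import all_classical all_reals all_analysis.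
From mathcomp Require Import zify ring.
Import Order.TTheory GRing.Theory Num.Theory.
Local Open Scope ring_scope.

(** * Inclusion-exclusion over finite sets *)

Lemma sum_subsets_setU1 (R : nmodType) (T : finType) (j : T) (B : {set T})
    (h : {set T} -> R) :
  j \notin B ->
  \sum_(S : {set T} | S \subset (j |: B)%SET) h S =
  \sum_(S : {set T} | S \subset B) (h S + h (j |: S)%SET).
Proof.
move=> jB; rewrite big_split/= (bigID (fun S : {set T} => j \in S))/= addrC.
congr (_ + _).
  apply: eq_bigl => S; apply/andP/idP => [[SB jS]|SB].
    apply/fintype.subsetP => x xS; have := fintype.subsetP SB x xS.
    by rewrite !inE => /orP[/eqP xj|//]; rewrite -xj xS in jS.
  split; last by apply: contra jB; exact: (fintype.subsetP SB).
  by rewrite (fintype.subset_trans SB)// finset.subsetUr.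
rewrite (reindex_onto (fun S => j |: S)%SET (fun S => S :\ j)%SET)/=; last first.
  by move=> S /andP[_ jS]; rewrite finset.setD1K.
apply: eq_bigl => S; rewrite setU11 andbT.
apply/andP/idP => [[SB /eqP SE]|SB].
  have jS : j \notin S by rewrite -SE !inE eqxx.
  apply/fintype.subsetP => x xS.
  have := fintype.subsetP SB x; rewrite !inE xS orbT => /(_ isT).
  by move=> /orP[/eqP xj|//]; rewrite -xj xS in jS.
have jS : j \notin S by apply: contra jB; exact: (fintype.subsetP SB).
by rewrite setU1K// eqxx finset.setUS.
Qed.

(** Think of [G A B] as the weight of the event where the conditions in [A] hold and those in [B]
    fail. Each induction step removes some [j] from [B], either dropping its condition or moving it
    to [A] with a minus sign. [G] stays abstract so that the result applies to a probability minus a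
    product. *)
Lemma inclusion_exclusion (R : pzRingType) (T : finType)
    (G : {set T} -> {set T} -> R) :
  (forall (A B : {set T}) j, j \notin A -> j \notin B ->
     G A (j |: B)%SET = G A B - G (j |: A)%SET B) ->
  forall A B : {set T}, [disjoint A & B] ->
  G A B = \sum_(S : {set T} | S \subset B)
            (-1) ^+ #|S| * G (A :|: S)%SET finset.set0.
Proof.
move=> GU A B; move: {2}(#|B|) (erefl #|B|) => m.
elim: m A B => [|m IH] A B.
  move=> /eqP; rewrite finset.cards_eq0 => /eqP -> _.
  rewrite (big_pred1 finset.set0) => [|S]; last by rewrite finset.subset0.
  by rewrite finset.cards0 mul1r finset.setU0.
move=> Bm dAB.
have [B0|[j jB]] := set_0Vmem B.
  by rewrite B0 finset.cards0 in Bm.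
have jA : j \notin A by rewrite (disjointFl dAB).
have jB' : j \notin (B :\ j)%SET by rewrite !inE eqxx.
have Bm' : #|(B :\ j)%SET| = m.
  by move: (cardsD1 j B); rewrite jB Bm => -[].
have dAB' : [disjoint A & (B :\ j)%SET].
  by apply: disjointWr dAB; exact: subD1set.
have djAB' : [disjoint (j |: A)%SET & (B :\ j)%SET].
  apply/pred0P => x /=; have [->|xj] := eqVneq x j; first by rewrite (negbTE jB') andbF.
  by rewrite !inE (negbTE xj)/=; case: (boolP (x \in A)) => //= /(disjointFr dAB).
rewrite -(finset.setD1K jB) GU// sum_subsets_setU1// (IH A)// (IH (j |: A)%SET)//.
rewrite -sumrB; apply: eq_bigr => S SB.
(* As [S] avoids [j], adding [j] raises the cardinality by one, which absorbs the minus sign of the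
   recursion. *)
rewrite cardsU1 (contra (fintype.subsetP SB j))// exprS mulN1r mulNr.
by rewrite finset.setUCA finset.setUA.
Qed.

Local Open Scope classical_set_scope.
Local Open Scope ring_scope.

(** * Iterated integrals over the unit cube *)

Section IteratedIntegral.
Context {R : realType} {n : nat}.
Implicit Types (f g h : ('I_n -> R) -> R) (u v : 'I_n -> R) (s : seq 'I_n).

Local Notation mu := (@lebesgue_measure R).
Local Notation U01 := (`[0%R, 1%R]%classic : set R).

Lemma Rintegral01_cst (r : R) : \int[mu]_(t in U01) r = r.
Proof.
by rewrite Rintegral_cst//= lebesgue_measure_itv/= lte_fin ltr01 sube0 mulr1.
Qed.

Lemma lebesgue_measure01_lty : (mu U01 < +oo)%E.
Proof. by rewrite lebesgue_measure_itv/= lte_fin ltr01 sube0 ltry. Qed.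

Lemma Rintegral01_id : \int[mu]_(t in U01) t = 2^-1 :> R.
Proof.
(* The integral of [1 - x] is [1/2]; subtracting it from the integral of [1] leaves that of [x]. *)
have := @Rintegral_onemXn R 1.
have -> : (fun x : R => (1 - x) ^+ 1) = (fun x : R => 1 - x).
  by apply/funext => x; rewrite expr1.
have cst_int (c : R) : mu.-integrable U01 (EFin \o (fun=> c)).
  apply: measurable_bounded_integrable => //.
    exact: lebesgue_measure01_lty.
  by exists `|c|; split => //= x cx y _ /=; exact: ltW.
rewrite RintegralB//.
  rewrite Rintegral01_cst => /(congr1 (fun z => 1 - z)).
  rewrite opprB addrCA subrr addr0 => ->.
  by rewrite {1}(splitr 1) mul1r addrK.
apply: measurable_bounded_integrable => //.
  exact: lebesgue_measure01_lty.
exists 1; split => //= x x1 y/=; rewrite in_itv/= => /andP[y0 y1].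
by rewrite ger0_norm// (le_trans y1)// ltW.
Qed.

(** Linearity of [Rintegral] requires integrability at each level of the iteration, so it is
    demanded of every partial integral, at every value of the remaining coordinates. *)
Fixpoint iter_integrable s f : Prop :=
  if s is i :: s' then iter_integrable s' f /\
    forall u, mu.-integrable U01 (EFin \o (fun t => iter_int s' f (setc u i t)))
  else True.

Lemma iter_int0 s u : iter_int s (fun=> 0 : R) u = 0.
Proof.
elim: s u => //= i s IH u.
by under eq_Rintegral do rewrite IH; rewrite Rintegral01_cst.
Qed.

Lemma iter_intZ s c f u : iter_integrable s f ->
  iter_int s (fun u => c * f u) u = c * iter_int s f u.
Proof.
elim: s u => //= i s IH u [fs fi].
by under eq_Rintegral do rewrite IH//; rewrite RintegralZl.
Qed.

Lemma iter_integrableZ s c f : iter_integrable s f ->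
  iter_integrable s (fun u => c * f u).
Proof.
elim: s => //= i s IH [fs fi]; split; first exact: IH.
move=> u; rewrite (_ : _ \o _ =
  (fun t => (c%:E * (iter_int s f (setc u i t))%:E)%E)).
  by apply: (integrableZl _ c (fi u)).
by apply/funext => t /=; rewrite iter_intZ.
Qed.

Lemma iter_intD s f g u : iter_integrable s f -> iter_integrable s g ->
  iter_int s (fun u => f u + g u) u = iter_int s f u + iter_int s g u.
Proof.
elim: s u => //= i s IH u [fs fi] [gs gi].
by under eq_Rintegral do rewrite IH//; rewrite RintegralD.
Qed.

Lemma iter_integrableD s f g : iter_integrable s f -> iter_integrable s g ->
  iter_integrable s (fun u => f u + g u).
Proof.
elim: s => //= i s IH [fs fi] [gs gi]; split; first exact: IH.
move=> u; rewrite (_ : _ \o _ = ((EFin \o (fun t => iter_int s f (setc u i t)))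
  \+ (EFin \o (fun t => iter_int s g (setc u i t))))%E).
  by apply: integrableD.
by apply/funext => t /=; rewrite iter_intD.
Qed.

Lemma iter_integrable0 s : iter_integrable s (fun=> 0).
Proof.
elim: s => //= i s IH; split => // u.
rewrite (_ : _ \o _ = cst 0%E); first exact: integrable0.
by apply/funext => t /=; rewrite iter_int0.
Qed.

Lemma iter_integrable_sum s (T : Type) (r : seq T) (p : pred T)
    (f : T -> ('I_n -> R) -> R) :
  (forall k, p k -> iter_integrable s (f k)) ->
  iter_integrable s (fun u => \sum_(k <- r | p k) f k u).
Proof.
move=> fs; elim: r => [|k r IH].
  under eq_fun => v do rewrite big_nil.
  exact: iter_integrable0.
case pk : (p k); under eq_fun => v do rewrite big_cons pk; last exact: IH.
by apply: iter_integrableD => //; exact: fs.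
Qed.

Lemma iter_int_sum s (T : Type) (r : seq T) (p : pred T)
    (f : T -> ('I_n -> R) -> R) u :
  (forall k, p k -> iter_integrable s (f k)) ->
  iter_int s (fun u => \sum_(k <- r | p k) f k u) u =
  \sum_(k <- r | p k) iter_int s (f k) u.
Proof.
move=> fs; elim: r => [|k r IH].
  under eq_fun => v do rewrite big_nil.
  by rewrite big_nil iter_int0.
rewrite big_cons; case pk : (p k);
  under eq_fun => v do rewrite big_cons pk; last exact: IH.
by rewrite iter_intD ?IH//; [exact: fs|exact: iter_integrable_sum].
Qed.

(* Monotonicity makes every iterated slice measurable, and is inherited by the
   partial integrals, so no joint measurability is needed. *)
Definition mono01 f :=
  (forall u, 0 <= f u <= 1) /\ (forall u v, (forall i, u i <= v i) -> f u <= f v).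

Lemma mono01_slice f u i : mono01 f ->
  mu.-integrable U01 (EFin \o (fun t => f (setc u i t))).
Proof.
move=> [f01 fm]; apply: measurable_bounded_integrable => //.
- exact: lebesgue_measure01_lty.
- apply: measurable_realfun.nondecreasing_measurable => // x y xy; apply: fm => j.
  by rewrite /setc; case: ifP.
- exists 1; split => //= x x1 y _ /=.
  by case/andP: (f01 (setc u i y)) => f0 f1; rewrite ger0_norm// (le_trans f1)// ltW.
Qed.

Lemma mono01_iter_int s f : mono01 f -> mono01 (iter_int s f).
Proof.
move=> mf; elim: s => //= i s IH; have [f01 fm] := IH; split => [u|u v uv].
  rewrite Rintegral_ge0/=; last by move=> t _; case/andP: (f01 (setc u i t)).
  rewrite -[leRHS]Rintegral01_cst le_Rintegral//.
  - exact: mono01_slice.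
  - have := @mono01_slice (fun=> 1) u i; apply.
    by split => // w; rewrite ler01 lexx.
  - by move=> t _; case/andP: (f01 (setc u i t)).
apply: le_Rintegral => //; [exact: mono01_slice..|].
by move=> t _; apply: fm => j; rewrite /setc; case: ifP.
Qed.

Lemma mono01_iter_integrable s f : mono01 f -> iter_integrable s f.
Proof.
move=> mf; elim: s => //= i s IH; split => // u.
by apply: mono01_slice; exact: mono01_iter_int.
Qed.

Lemma mono01_prod (K : {pred 'I_n}) s (F : 'I_n -> R -> R) :
  (forall i t, 0 <= F i t <= 1) -> (forall i, {homo F i : x y / x <= y}) ->
  mono01 (fun u => \prod_(i <- s | i \in K) F i (u i)).
Proof.
move=> F01 Fm; split => [u|u v uv].
  by rewrite prodr_ge0 ?prodr_ile1// => i _; case/andP: (F01 i (u i)).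
by apply: ler_prod => i _; rewrite Fm// andbT; case/andP: (F01 i (u i)).
Qed.

Lemma iter_int_dep (K : {set 'I_n}) f s u v :
  (forall u v, (forall i, i \in K -> u i = v i) -> f u = f v) ->
  (forall i, i \in K -> u i = v i) -> iter_int s f u = iter_int s f v.
Proof.
move=> fK; elim: s u v => [|i s IH] u v uv /=; first exact: fK.
apply: eq_Rintegral => t _; apply: IH => j jK.
by rewrite /setc; case: ifP => // _; exact: uv.
Qed.

Lemma iter_int_filter (K : {set 'I_n}) f s u :
  (forall u v, (forall i, i \in K -> u i = v i) -> f u = f v) ->
  iter_int s f u = iter_int [seq i <- s | i \in K] f u.
Proof.
move=> fK; elim: s u => //= i s IH u; case: ifPn => iK /=.
  by apply: eq_Rintegral => t _; exact: IH.
rewrite -IH -[RHS]Rintegral01_cst; apply: eq_Rintegral => t _.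
apply: (iter_int_dep K) => // j jK; rewrite /setc; case: eqP => // ji.
by rewrite -ji jK in iK.
Qed.

(** This links the integral over the full cube in [rho_alpha] to the lower-dimensional ones in
    [rho_minus]. The two lists of coordinates are filters of one enumeration, hence come in the same
    order. *)
Lemma cube_int_setT (K : {set 'I_n}) f :
  (forall u v, (forall i, i \in K -> u i = v i) -> f u = f v) ->
  cube_int [set: 'I_n]%SET f = cube_int K f.
Proof.
move=> fK; rewrite /cube_int (iter_int_filter K)//; congr (iter_int _ _ _).
rewrite /enum_mem -filter_predI; apply: eq_filter => i /=.
by rewrite !inE andbT.
Qed.

Lemma iter_int_mulfree g h s u : iter_integrable s h ->
  (forall u i t, i \in s -> g (setc u i t) = g u) ->
  iter_int s (fun u => g u * h u) u = g u * iter_int s h u.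
Proof.
elim: s u => //= i s IH u [hs hi] gs.
under eq_Rintegral => t _.
  rewrite IH//; last by move=> w j r js; apply: gs; rewrite inE js orbT.
  rewrite gs ?mem_head//.
  over.
by rewrite RintegralZl.
Qed.

(** The factor of the outermost coordinate is constant for the inner integrals, since [uniq s] keeps
    them from touching it, and it is pulled out. Bounds and monotonicity of [F] provide
    integrability. *)
Lemma iter_int_prod s (F : 'I_n -> R -> R) u : uniq s ->
  (forall i t, 0 <= F i t <= 1) -> (forall i, {homo F i : x y / x <= y}) ->
  iter_int s (fun u => \prod_(i <- s) F i (u i)) u =
  \prod_(i <- s) \int[mu]_(t in U01) F i t.
Proof.
move=> + F01 Fm; elim: s u => [|i s IH] u /=; first by rewrite !big_nil.
move=> /andP[iNs us]; rewrite big_cons.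
under eq_Rintegral => t _.
  under eq_fun do rewrite big_cons.
  rewrite (@iter_int_mulfree (fun u => F i (u i))); last 2 first.
  - apply: mono01_iter_integrable.
    exact: (@mono01_prod predT).
  - move=> w j r js; rewrite /setc; case: eqP => // ij.
    by rewrite ij js in iNs.
  rewrite IH//= /setc eqxx.
  over.
rewrite RintegralZr//.
(* Viewing [F i] as a slice of a function of the whole vector makes [mono01_slice] applicable. *)
rewrite (_ : _ \o _ = EFin \o (fun t => F i (setc u i t i))).
  by apply: (@mono01_slice (fun u => F i (u i))); split => // w v wv; exact: Fm.
by apply/funext => t /=; rewrite /setc eqxx.
Qed.

Lemma cube_int_prod (K : {set 'I_n}) (F : 'I_n -> R -> R) :
  (forall i t, 0 <= F i t <= 1) -> (forall i, {homo F i : x y / x <= y}) ->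
  cube_int K (fun u => \prod_(i in K) F i (u i)) =
  \prod_(i in K) \int[mu]_(t in U01) F i t.
Proof.
move=> F01 Fm; under eq_fun do rewrite -big_enum.
by rewrite /cube_int iter_int_prod ?enum_uniq// big_enum.
Qed.

End IteratedIntegral.

(** * Orthant probabilities and their inclusion-exclusion *)

Section Orthants.
Context {R : realType} {n : nat} {d : measure_display} {Omega : measurableType d}.
Context (P : probability Omega R) (X : 'I_n -> Omega -> R).
Implicit Types (A B K : {set 'I_n}) (u v : 'I_n -> R).

Local Notation mu := (@lebesgue_measure R).

Lemma ae_eq_measure (E F : set Omega) : measurable E -> measurable F ->
  {ae P, forall w, E w <-> F w} -> P E = P F.
Proof.
move=> mE mF [N [mN N0 EFN]].
(* Adjoining the null set [N], which contains all points of disagreement, makes the two events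
   equal. *)
rewrite -(measureU0 mE mN N0) -(measureU0 mF mN N0); congr (P _).
by apply/seteqP; split => w [Ew|Nw]; try (by right);
  (have [EF|EF] := pselect (E w <-> F w); [left; exact/EF|right; exact: EFN]).
Qed.

(** Large inequalities on [A] and strict ones on [B] are exact complements, so moving an index from
    [B] to [A] costs no null set. *)
Definition orthant A B u : set Omega :=
  [set w | (forall i, i \in A -> X i w <= u i) /\
           (forall i, i \in B -> u i < X i w)].

(** Unlike the identity, with which it agrees on [[0, 1]], it takes values in [[0, 1]] on the whole
    line, as [mono01] asks. *)
Definition cdf (i : 'I_n) (t : R) : R := fine (P [set w | X i w <= t]).

Hypothesis mX : forall i, measurable_fun setT (X i).

Lemma measurable_forall (T : finType) (Z : T -> set Omega) :
  (forall i, measurable (Z i)) -> measurable [set w | forall i, Z i w].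
Proof.
move=> mZ; rewrite (_ : [set _ | _] = \bigcap_(i in [set: T]) Z i).
  by apply: fin_bigcap_measurable => // ; exact: finite_finset.
by apply/seteqP; split => w /= Zw i; [move=> _; exact: Zw|exact: Zw].
Qed.

Lemma measurable_le i t : measurable [set w | X i w <= t].
Proof.
rewrite -[X in measurable X]setTI -[X in _ `&` X]/(X i @^-1` [set x | x <= t]).
by apply: mX => //; rewrite -set_itvNyc.
Qed.

Lemma measurable_lt i t : measurable [set w | X i w < t].
Proof.
rewrite -[X in measurable X]setTI -[X in _ `&` X]/(X i @^-1` [set x | x < t]).
by apply: mX => //; rewrite -set_itvNyo.
Qed.

Lemma measurable_gt i t : measurable [set w | t < X i w].
Proof.
rewrite -[X in measurable X]setTI -[X in _ `&` X]/(X i @^-1` [set x | t < x]).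
by apply: mX => //; rewrite -set_itvoy.
Qed.

Lemma measurable_orthant A B u : measurable (orthant A B u).
Proof.
rewrite /orthant (_ : [set _ | _] =
    [set w | forall i, (i \in A -> X i w <= u i)] `&`
    [set w | forall i, (i \in B -> u i < X i w)]); last by [].
apply: measurableI; apply: measurable_forall => i.
  case: (i \in A); last by rewrite (_ : (fun _ => _) = setT)//; apply/seteqP.
  rewrite (_ : (fun _ => _) = [set w | X i w <= u i]); first exact: measurable_le.
  by apply/seteqP; split => w /=; [exact|].
case: (i \in B); last by rewrite (_ : (fun _ => _) = setT)//; apply/seteqP.
rewrite (_ : (fun _ => _) = [set w | u i < X i w]); first exact: measurable_gt.
by apply/seteqP; split => w /=; [exact|].
Qed.

Lemma fine_le_probability (E F : set Omega) : measurable E -> measurable F ->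
  E `<=` F -> fine (P E) <= fine (P F).
Proof. by move=> mE mF EF; rewrite fine_le ?fin_num_measure// le_measure ?inE. Qed.

Lemma fine_probability01 (E : set Omega) : measurable E -> 0 <= fine (P E) <= 1.
Proof.
move=> mE; rewrite fine_ge0//=.
by rewrite -[leRHS]/(fine (1%E : \bar R)) fine_le ?fin_num_measure// probability_le1.
Qed.

Lemma cdf01 i t : 0 <= cdf i t <= 1.
Proof. by apply: fine_probability01; exact: measurable_le. Qed.

Lemma cdf_homo i : {homo cdf i : x y / x <= y}.
Proof.
move=> x y xy; apply: fine_le_probability; [exact: measurable_le..|].
by move=> w /= /le_trans; exact.
Qed.

(** Conditions [u i < X i w] would make the probability decrease in [u i]. This is why
    inclusion-exclusion is carried out pointwise, before integrating. *)
Lemma mono01_orthant A : mono01 (fun u => fine (P (orthant A finset.set0 u))).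
Proof.
split=> [u|u v uv]; first by apply: fine_probability01; exact: measurable_orthant.
apply: fine_le_probability; [exact: measurable_orthant..|].
move=> w [Aw _]; split => [i iA|i]; last by rewrite inE.
exact: le_trans (Aw i iA) _.
Qed.

Lemma mono01_prod_cdf A : mono01 (fun u => \prod_(i in A) cdf i (u i)).
Proof. by apply: mono01_prod; [exact: cdf01|exact: cdf_homo]. Qed.

Lemma probability_orthantU1 A B j u :
  fine (P (orthant A (j |: B)%SET u)) =
  fine (P (orthant A B u)) - fine (P (orthant (j |: A)%SET B u)).
Proof.
have -> : orthant A B u = orthant A (j |: B)%SET u `|` orthant (j |: A)%SET B u.
  apply/seteqP; split => w.
    move=> [Aw Bw]; have [uX|Xu] := ltP (u j) (X j w); [left|right]; split => //.
      by move=> i /setU1P[->//|]; exact: Bw.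
    by move=> i /setU1P[->//|]; exact: Aw.
  move=> [] [Aw Bw]; split => i iAB; try exact: Aw; try exact: Bw.
    by apply: Bw; rewrite in_setU1 iAB orbT.
  by apply: Aw; rewrite in_setU1 iAB orbT.
rewrite measureU; [|exact: measurable_orthant..|].
  by rewrite fineD ?fin_num_measure ?addrK//; exact: measurable_orthant.
apply/seteqP; split => // w [[_ Bw] [Aw _]].
have := Bw j (setU11 _ _); have := Aw j (setU11 _ _).
by rewrite leNgt => /negbTE ->.
Qed.

(* Excess of an orthant probability over the independent one; as a function of
   [(A, B)] both terms satisfy the inclusion-exclusion recursion. *)
Definition excess u A B : R := fine (P (orthant A B u)) -
  \prod_(i in A) cdf i (u i) * \prod_(i in B) (1 - cdf i (u i)).

Lemma excess_inclusion_exclusion u A B : [disjoint A & B]%B ->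
  excess u A B = \sum_(S : {set 'I_n} | S \subset B)
    (-1) ^+ #|S| * excess u (A :|: S)%SET finset.set0.
Proof.
move=> AB; apply: (@inclusion_exclusion _ _ (excess u)) AB => A' B' j jA jB.
(* On the product side the recursion is the expansion of the factor [1 - cdf j (u j)]. *)
rewrite /excess probability_orthantU1 !big_setU1//=.
ring.
Qed.

(** * Consequences of uniform marginals *)

Hypothesis uX : forall i (E : set R), measurable E ->
  P (X i @^-1` E) = mu (E `&` `[0%R, 1%R]).

(** Points are Lebesgue-null and there are finitely many coordinates. This lets strict and large
    inequalities be exchanged. *)
Lemma ae_X_neq u : {ae P, forall w, forall i, X i w != u i}.
Proof.
apply: filter_forall => i; exists (X i @^-1` [set u i]); split.
- by rewrite -[X in measurable X]setTI; exact: mX.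
- rewrite uX//; apply: (@subset_measure0 _ _ _ mu _ [set u i]) => //.
  + exact: measurableI.
  + exact: lebesgue_measure_set1.
- by move=> w /= /negP; rewrite negbK => /eqP.
Qed.

(** Hence the arguments set to 1 in [copula_marg] impose no constraint almost surely. *)
Lemma ae_X_le1 : {ae P, forall w, forall i, X i w <= 1}.
Proof.
apply: filter_forall => i; exists (X i @^-1` `]1, +oo[); split.
- by rewrite -[X in measurable X]setTI; exact: mX.
- rewrite uX// (_ : _ `&` _ = set0) ?measure0//.
  apply/seteqP; split => // x [] /=; rewrite !in_itv/= andbT => x1 /andP[_].
  by rewrite leNgt x1.
- by move=> w /= /negP; rewrite -ltNge in_itv/= andbT.
Qed.

Lemma copula_margE K u : copula_marg P X K u = fine (P (orthant K finset.set0 u)).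
Proof.
rewrite /copula_marg /copula; congr fine; apply: ae_eq_measure.
- by apply: measurable_forall => i; exact: measurable_le.
- exact: measurable_orthant.
- apply: filterS ae_X_le1 => w X1; split => [Xw|[Xw _] i].
    by split => i; [move=> iK; move: (Xw i); rewrite iK|rewrite inE].
  by case: ifPn => // /Xw.
Qed.

Lemma Q_alphaE (alpha : 'I_n -> int) u :
  (forall i, alpha i = 1 \/ alpha i = -1) ->
  let I := [set i | alpha i == -1]%SET in
  Q_alpha P X alpha u = excess u I (~: I)%SET.
Proof.
move=> alphaE I.
(* Multiplying by [-1] reverses the inequality, so the indices in [I] are those bounded from
   above. *)
have dirE i x y : ((alpha i)%:~R * x < (alpha i)%:~R * y :> R) =
    if i \in I then y < x else x < y.
  rewrite inE; case: (alphaE i) => ->; first by rewrite !mul1r.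
  by rewrite eqxx !mulN1r ltrN2.
have mdir i : measurable [set w | (alpha i)%:~R * u i < (alpha i)%:~R * X i w].
  case iI : (i \in I); under eq_set do rewrite dirE iI;
    [exact: measurable_lt|exact: measurable_gt].
rewrite /Q_alpha /excess; congr (_ - _).
  congr fine; apply: ae_eq_measure.
  - exact: measurable_forall.
  - exact: measurable_orthant.
  - apply: filterS (ae_X_neq u) => w Xu; split => [Xw|[Iw Jw] i].
      split => i iI; have := Xw i; rewrite /= dirE.
        by rewrite iI => /ltW.
      by move: iI; rewrite finset.in_setC => /negbTE ->.
    rewrite /= dirE; case: ifPn => iI; first by rewrite lt_neqAle Xu Iw.
    by apply: Jw; rewrite finset.in_setC.
(* Outside [I] the factor is exactly the complement of a [cdf] event; inside [I] it matches [cdf] up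
   to the null set [X i = u i]. *)
rewrite (bigID (mem I))/=; congr (_ * _); last first.
  apply: eq_big => [i|i iI]; first by rewrite finset.in_setC.
  under eq_set do rewrite dirE (negbTE iI).
  rewrite /cdf -[X in X - _]/(fine (1%E : \bar R)).
  rewrite -fineB ?fin_num_measure//; last exact: measurable_le.
  rewrite -probability_setC; last exact: measurable_le.
  congr (fine (P _)); apply/seteqP; split => w /=; first by rewrite ltNge => /negP.
  by move=> /negP; rewrite ltNge.
apply: eq_bigr => i iI; congr fine; apply: ae_eq_measure => //.
  exact: measurable_le.
apply: filterS (ae_X_neq u) => w Xu /=; rewrite dirE iI; split => [/ltW//|Xle].
by rewrite lt_neqAle Xu.
Qed.

Lemma cdf_id i t : 0 <= t <= 1 -> cdf i t = t.
Proof.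
move=> /andP[t0 t1]; rewrite /cdf -[[set _ | _]]/(X i @^-1` [set x | x <= t]).
rewrite -set_itvNyc uX// (_ : _ `&` _ = `[0, t]%classic).
  (* The length formula tests [0 < t]; otherwise [t = 0] and the measure is 0 as well. *)
  rewrite lebesgue_measure_itv/= lte_fin; case: ltP => [_|]; first by rewrite sube0.
  by move=> t0'; apply/eqP; rewrite eq_le t0 t0'.
apply/seteqP; split => x /=; rewrite !in_itv/=.
  by move=> [xt /andP[x0 _]]; rewrite x0.
by move=> /andP[x0 xt]; rewrite xt x0 (le_trans xt).
Qed.

Lemma Rintegral_cdf i : \int[mu]_(t in `[0%R, 1%R]) cdf i t = 2^-1.
Proof.
rewrite -Rintegral01_id; apply: eq_Rintegral => t.
by rewrite inE/= in_itv/= => /cdf_id.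
Qed.

Lemma cube_int_prod_cdf K :
  cube_int K (fun u => \prod_(i in K) cdf i (u i)) = 2^-1 ^+ #|K|.
Proof.
rewrite cube_int_prod; [|exact: cdf01|exact: cdf_homo].
by under eq_bigr do rewrite Rintegral_cdf; rewrite prodr_const.
Qed.

Lemma orthant_card_le1 K u : (#|K| <= 1)%N ->
  fine (P (orthant K finset.set0 u)) = \prod_(i in K) cdf i (u i).
Proof.
rewrite leq_eqVlt => /orP[/cards1P[i ->]|].
  rewrite big_set1; congr (fine (P _)); apply/seteqP; split => w.
    by move=> [Xw _]; apply: Xw; rewrite inE.
  by move=> Xw; split => j; rewrite inE// => /eqP ->.
rewrite ltnS leqn0 finset.cards_eq0 => /eqP ->; rewrite big_set0.
rewrite (_ : orthant _ _ _ = setT) ?probability_setT//.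
by apply/seteqP; split => // w _; split => i; rewrite inE.
Qed.

(* For [k <= 1] both sides vanish: [rho_minus] is then [_ / 0 = 0], and [C_K]
   coincides with the independence copula. *)
Lemma rho_minus_coef K (k := #|K|) :
  (2 ^+ k - k.+1%:R) / (2 ^+ k * k.+1%:R) * rho_minus P X K =
  cube_int K (fun u => fine (P (orthant K finset.set0 u))) - 2^-1 ^+ k.
Proof.
rewrite /rho_minus -/k (_ : copula_marg P X K =
    fun u => fine (P (orthant K finset.set0 u))); last first.
  by apply/funext => u; rewrite copula_margE.
have [k1|k1] := leqP k 1.
  under [in RHS]eq_fun do rewrite orthant_card_le1//.
  rewrite cube_int_prod_cdf subrr.
  rewrite (_ : 2 ^+ k - k.+1%:R = 0 :> R) ?mul0r//.
  by move: k1; case: (k) => [|[]]// _; rewrite ?expr0 ?expr1 subrr.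
have k2 : 2 ^+ k - k.+1%:R != 0 :> R.
  rewrite subr_eq0 -natrX eqr_nat gtn_eqF//.
  (* Induction shows that [k.+1 < 2 ^ k] from [k = 2] on, starting with [3 < 4]. *)
  by elim: (k) k1 => // -[//|[//|m]] IH _; rewrite expnS; have := IH isT; lia.
set c := cube_int _ _; rewrite exprVn.
(* Here [a] stands for [2 ^+ k] and [b] for [k.+1%:R], so that [field] sees plain variables. *)
have cancel (a b : R) : a != 0 -> b != 0 -> a - b != 0 ->
    (a - b) / (a * b) * (b / (a - b) * (a * c - 1)) = c - a^-1.
  by move=> a0 b0 ab0; field; rewrite ab0 b0 a0.
have k3 : k.+1%:R != 0 :> R by rewrite pnatr_eq0.
have k4 : 2 ^+ k != 0 :> R by rewrite expf_neq0// pnatr_eq0.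
exact: cancel.
Qed.

End Orthants.

(** * Termwise integration of the expansion *)

Theorem mainTheorem3 (R : realType) (n : nat) (d : measure_display)
  (Omega : measurableType d) (P : probability Omega R) (X : 'I_n -> Omega -> R)
  (alpha : 'I_n -> int) :
  (2 <= n)%N ->
  (forall i, measurable_fun setT (X i)) ->
  (forall i (A : set R), measurable A ->
     P (X i @^-1` A) = (@lebesgue_measure R) (A `&` `[0%R, 1%R])) ->
  (forall i, alpha i = 1 \/ alpha i = -1) ->
  let I : {set 'I_n} := [set i | alpha i == -1]%SET in
  let J : {set 'I_n} := (~: I)%SET in
  rho_alpha P X alpha =
    (2 ^+ n * (n.+1)%:R) / (2 ^+ n - (n.+1)%:R) *
    \sum_(S : {set 'I_n} | S \subset J)
      (-1) ^+ #|S| *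
      ((2 ^+ (#|I| + #|S|) - (#|I| + #|S|).+1%:R) /
         (2 ^+ (#|I| + #|S|) * (#|I| + #|S|).+1%:R)) *
      rho_minus P X (I :|: S)%SET.
Proof.
move=> _ mX uX alphaE I J; rewrite /rho_alpha; congr (_ * _).
(* The difference is written as a sum with a factor [-1] to fit the additivity and scaling lemmas
   for iterated integrals. *)
have -> : Q_alpha P X alpha = fun u => \sum_(S : {set 'I_n} | S \subset J)
    (-1) ^+ #|S| * (fine (P (orthant X (I :|: S)%SET finset.set0 u)) +
      -1 * \prod_(i in (I :|: S)%SET) cdf P X i (u i)).
  apply/funext => u; rewrite Q_alphaE// excess_inclusion_exclusion//.
    by apply: eq_bigr => S _; rewrite /excess big_set0 mulr1 mulN1r.
  by rewrite finset.disjoints_subset finset.setCK.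
have orthantI K : iter_integrable (enum [set: 'I_n]%SET)
    (fun u => fine (P (orthant X K finset.set0 u))).
  by apply: mono01_iter_integrable; exact: mono01_orthant.
have prodI (K : {set 'I_n}) : iter_integrable (enum [set: 'I_n]%SET)
    (fun u => \prod_(i in K) cdf P X i (u i)).
  by apply: mono01_iter_integrable; exact: mono01_prod_cdf.
have prodNI K := iter_integrableZ _ (-1) _ (prodI K).
have diffI K := iter_integrableD _ _ _ (orthantI K) (prodNI K).
rewrite {1}/cube_int iter_int_sum; last first.
  by move=> S _; apply: iter_integrableZ; exact: diffI.
apply: eq_bigr => S SJ.
(* Cardinalities add up because [S] lies in the complement of [I]. *)
have IS : (#|I| + #|S|)%N = #|(I :|: S)%SET|.
  rewrite finset.cardsU (_ : (I :&: S)%SET = finset.set0) ?finset.cards0 ?subn0//.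
  by apply/eqP; rewrite setI_eq0 disjoint_sym finset.disjoints_subset.
rewrite IS -mulrA rho_minus_coef// iter_intZ// iter_intD// iter_intZ// mulN1r.
(* Both integrands read only the coordinates in [I :|: S], so each integral over the full cube
   reduces to those coordinates. *)
congr (_ * (_ - _)).
  rewrite -/(cube_int _ _); apply: cube_int_setT => u v uv.
  congr (fine (P _)); apply/seteqP; split => w [Xw _]; split => i iK;
    try by rewrite inE in iK.
    by rewrite -uv//; exact: Xw.
  by rewrite uv//; exact: Xw.
rewrite -(cube_int_prod_cdf P X mX uX) -/(cube_int _ _); apply: cube_int_setT => u v uv.
by apply: eq_bigr => i iK; rewrite uv.
Qed.
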